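(* Let $\Sigma: x^+=Ax+Bu+Ew$ be a discrete-time linear system with $A$ nilpotent of nilpotency index $\nu$, and let the safe set $S_{xu}\subset\mathbb{R}^n\times\mathbb{R}^m$ and the disturbance set $W\subset\mathbb{R}^d$ be polytopes. Let $q\in\mathbb{N}$, let $P\in\mathbb{R}^{mq\times mq}$ and $H\in\mathbb{R}^{m\times mq}$ be arbitrary matrices, and let $\mathcal{C}_{xv}$ be an RPIS of the companion system $\Sigma_{xv}$ within the companion safe set $S_{xv}$. Then $\pi_n(\mathcal{C}_{xv})\subseteq\mathcal{C}_{outer,\nu}$.
   Context: Setting: $x\in\mathbb{R}^n$, $u\in\mathbb{R}^m$, $w\in W$; $A\in\mathbb{R}^{n\times n}$, $B\in\mathbb{R}^{n\times m}$, $E\in\mathbb{R}^{n\times d}$. $\nu$ is the smallest positive integer with $A^\nu=0$. A polytope is a bounded set of the form $\{z\mid Gz\le f\}$. Sums of sets are Minkowski sums; $Q-P=\{z\mid z+p\in Q\ \forall p\in P\}$. $\pi_n$ is the projection onto the first $n$ coordinates. $\overline{W}_t=\sum_{i=1}^tA^{i-1}EW$ (with $\overline{W}_0=\{0\}$) and $\overline{W}_\infty=\sum_{i=1}^{\nu}A^{i-1}EW$. Reachable set: $\mathcal{R}_\Sigma(x,\{u_i\}_{i=0}^{t-1})=A^tx+\sum_{i=1}^tA^{i-1}Bu_{t-i}+\overline{W}_t$, with $\mathcal{R}_\Sigma(x,\emptyset)=\{x\}$. For a set $R\subseteq\mathbb{R}^n$ and $u\in\mathbb{R}^m$, $(R,u)$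 denotes $R\times\{u\}$. RPIS: for a system $z^+=Fz+Gw$, $w\in W$, a set $\mathcal{C}\subseteq S$ is a robust positively invariant set (RPIS) within $S$ if $z\in\mathcal{C}$ implies $Fz+Gw\in\mathcal{C}$ for all $w\in W$. Companion system $\Sigma_{xv}$: $x^+=Ax+BHv+Ew$, $v^+=Pv$, $w\in W$, with $(x,v)\in\mathbb{R}^n\times\mathbb{R}^{mq}$; companion safe set $S_{xv}=\{(x,v)\mid(x,Hv)\in S_{xu}\}$. Nominal system and safe set: $\overline{\Sigma}: x^+=Ax+Bu$ and $\overline{S}_{xu}=S_{xu}-\overline{W}_\infty\times\{0\}$. A controlled invariant set (CIS) of $\overline{\Sigma}$ within $\overline{S}_{xu}$ is a set $\mathcal{C}$ such that for every $x\in\mathcal{C}$ there is $u$ with $(x,u)\in\overline{S}_{xu}$ and $Ax+Bu\in\mathcal{C}$; $\overline{\mathcal{C}}_{\max}$ is the maximal (largest) such set. Define $$\mathcal{C}_{outer,\nu}=\Big\{x\in\mathbb{R}^n\ \Big|\ \exists\{u_i\}_{i=0}^{\nu-1}\in\mathbb{R}^{m\nu}:\ (\mathcal{R}_\Sigma(x,\{u_i\}_{i=0}^{t-1}),u_t)\subseteq S_{xu},\ t=0,\dots,\nu-1,\ \ \mathcal{R}_\Sigma(x,\{u_i\}_{i=0}^{\nu-1})\subseteq\overline{\mathcal{C}}_{\max}+\overline{W}_\infty\Big\}.$$ *)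

(* Defs.v *)
From HB Require Import structures.
From mathcomp Require Import all_boot all_order all_algebra.
From mathcomp Require Import boolp classical_sets reals topology normedtype.

Set Implicit Arguments.
Unset Strict Implicit.
Unset Printing Implicit Defensive.

Import Order.TTheory GRing.Theory Num.Theory.
Import numFieldNormedType.Exports.
Local Open Scope classical_set_scope.
Local Open Scope ring_scope.

(* R^n x R^m is identified with R^(n + m) through [col_mx]. *)

Section SetOperations.

Definition msum (V : zmodType) (P Q : set V) : set V :=
  [set p + q | p in P & q in Q].

Definition mdiff (V : zmodType) (Q P : set V) : set V :=
  [set z | forall p, P p -> Q (z + p)].

Definition cart (R : realType) (n m : nat) (X : set 'cV[R]_n)
    (Y : set 'cV[R]_m) : set 'cV[R]_(n + m) :=
  [set col_mx x y | x in X & y in Y].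

Definition proj_fst (R : realType) (n m : nat)
    (Z : set 'cV[R]_(n + m)) : set 'cV[R]_n :=
  [set usubmx z | z in Z].

Definition polytope (R : realType) (k : nat) (Q : set 'cV[R]_k) : Prop :=
  bounded_set Q /\
  exists (r : nat) (G : 'M[R]_(r, k)) (f : 'cV[R]_r),
    Q = [set z | forall i, (G *m z) i 0 <= f i 0].

End SetOperations.

Definition nilpotency_index (R : realType) (n : nat) (A : 'M[R]_n)
    (nu : nat) : Prop :=
  [/\ (0 < nu)%N, A ^+ nu = 0 &
      forall k : nat, (0 < k)%N -> A ^+ k = 0 -> (nu <= k)%N].

Definition RPIS (R : realType) (k d : nat) (F : 'M[R]_k) (G : 'M[R]_(k, d))
    (W : set 'cV[R]_d) (S C : set 'cV[R]_k) : Prop :=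
  C `<=` S /\ forall z, C z -> forall w, W w -> C (F *m z + G *m w).

Section LinearSystem.
Variables (R : realType) (n m d : nat).
Variables (A : 'M[R]_n) (B : 'M[R]_(n, m)) (E : 'M[R]_(n, d)).
Variables (Sxu : set 'cV[R]_(n + m)) (W : set 'cV[R]_d).

Definition Wbar (t : nat) : set 'cV[R]_n :=
  \big[@msum _ / [set 0]]_(1 <= i < t.+1)
     [set A ^+ i.-1 *m (E *m w) | w in W].

Definition Wbar_inf (nu : nat) : set 'cV[R]_n := Wbar nu.

(* [us] lists u_0, ..., u_(t-1); the horizon t is its length. *)
Definition reach (x : 'cV[R]_n) (us : seq 'cV[R]_m) : set 'cV[R]_n :=
  let t := size us in
  msum [set A ^+ t *m x +
            \sum_(1 <= i < t.+1) A ^+ i.-1 *m (B *m us`_(t - i))]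
       (Wbar t).

Section Companion.
Variables (q : nat) (P : 'M[R]_(m * q)) (H : 'M[R]_(m, m * q)).

Definition companion_mx : 'M[R]_(n + m * q) := block_mx A (B *m H) 0 P.

Definition companion_dist : 'M[R]_(n + m * q, d) := col_mx E 0.

Definition companion_safe : set 'cV[R]_(n + m * q) :=
  [set z | Sxu (col_mx (usubmx z) (H *m dsubmx z))].

Lemma companionE (x : 'cV[R]_n) (v : 'cV[R]_(m * q)) (w : 'cV[R]_d) :
  companion_mx *m col_mx x v + companion_dist *m w =
  col_mx (A *m x + B *m H *m v + E *m w) (P *m v).
Proof.
by rewrite mul_block_col mul_col_mx !mul0mx add0r add_col_mx addr0.
Qed.

End Companion.

Definition nominal_safe (nu : nat) : set 'cV[R]_(n + m) :=
  mdiff Sxu (cart (Wbar_inf nu) [set 0]).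

Definition CIS (S : set 'cV[R]_(n + m)) (C : set 'cV[R]_n) : Prop :=
  forall x, C x ->
    exists u : 'cV[R]_m, S (col_mx x u) /\ C (A *m x + B *m u).

Definition max_CIS (S : set 'cV[R]_(n + m)) : set 'cV[R]_n :=
  \bigcup_(C in [set C | CIS S C]) C.

Lemma max_CIS_CIS (S : set 'cV[R]_(n + m)) : CIS S (max_CIS S).
Proof.
move=> x [C cisC Cx]; have [u [Su Cu]] := cisC x Cx.
by exists u; split=> //; exists C.
Qed.

Lemma max_CIS_max (S : set 'cV[R]_(n + m)) (C : set 'cV[R]_n) :
  CIS S C -> C `<=` max_CIS S.
Proof. by move=> cisC x Cx; exists C. Qed.

Definition C_outer (nu : nat) : set 'cV[R]_n :=
  [set x | exists us : nu.-tuple 'cV[R]_m,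
     (forall t : nat, (t < nu)%N ->
        cart (reach x (take t us)) [set us`_t] `<=` Sxu) /\
     reach x us `<=` msum (max_CIS (nominal_safe nu)) (Wbar_inf nu)].

End LinearSystem.

(* Main.v *)
Require Import Defs.
From mathcomp Require Import all_boot all_order all_algebra.
From mathcomp Require Import boolp classical_sets reals topology normedtype.
Local Open Scope classical_set_scope.

(** Fix a point (x, v) of the RPIS and feed the plant with the inputs
    u_t = H P^t v produced by the companion system.  Let X_t be the nominal
    (undisturbed) state at time t.  By linearity the states reachable at time t
    are exactly X_t + Wbar_t ([reach_nominal_state]), and robust invariance
    places each of them, paired with P^t v, in the RPIS ([RPIS_nominal_state]).
    Since the RPIS lies in the companion safe set, this gives the safety
    constraints in the definition of the outer set.

    For the terminal constraint, nilpotency freezes the disturbance sets: as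
    A^nu = 0, Wbar_nu is contained in Wbar_t for all t >= nu
    ([Wbar_nilpotent_sub]).  Thus X_t + Wbar_nu is safe under the input u_t for
    every t >= nu, which says that (X_t, u_t) is in the nominal safe set.  The
    nominal tail {X_t | t >= nu} is therefore a CIS of the nominal system
    ([nominal_tail_CIS]), hence contained in the maximal one, and the set
    reachable at time nu is X_nu + Wbar_nu. *)

Set Implicit Arguments.
Unset Strict Implicit.

Import GRing.Theory.
Local Open Scope ring_scope.

(** * Disturbance sets *)

Lemma image_msum (U V : zmodType) (f : {additive U -> V}) (P Q : set U) :
  f @` msum P Q = msum (f @` P) (f @` Q).
Proof.
apply/seteqP; split=> y.
  move=> [_ [p Pp [q Qq <-]] <-]; rewrite raddfD.
  by exists (f p); [exists p | exists (f q); [exists q|]].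
move=> [_ [p Pp <-] [_ [q Qq <-] <-]]; rewrite -raddfD.
by exists (p + q) => //; exists p => //; exists q.
Qed.

Lemma mulmx_exprS (R : pzRingType) (n p : nat) (A : 'M[R]_n) k (X : 'M_(n, p)) :
  A ^+ k.+1 *m X = A *m (A ^+ k *m X).
Proof. by rewrite exprS mulmxA. Qed.

Section DisturbanceSets.
Context (R : realType) (n d : nat).
Context (A : 'M[R]_n) (E : 'M[R]_(n, d)) (W : set 'cV[R]_d).

Lemma Wbar0 : Wbar A E W 0 = [set 0].
Proof. by rewrite /Wbar big_geq. Qed.

(** The one-step recursion in time: the defining sum grows by its
    highest-power term, whereas propagating a state by one step applies A to
    all past disturbances and adds a fresh one. *)
Lemma WbarS t :
  Wbar A E W t.+1 = msum [set E *m w | w in W] (mulmx A @` Wbar A E W t).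
Proof.
rewrite /Wbar big_ltn //; congr msum.
  by apply: eq_imagel => w _; rewrite expr0 mul1mx.
have id0 : mulmx A @` [set 0] = [set 0] :> set 'cV[R]_n.
  by rewrite image_set1 mulmx0.
rewrite (big_morph (fun X : set 'cV[R]_n => mulmx A @` X) (image_msum (mulmx A)) id0).
rewrite big_add1 /= !big_add1 /=; apply: eq_bigr => i _.
rewrite [RHS]image_comp; apply: eq_imagel => w _ /=.
by rewrite mulmx_exprS.
Qed.

Lemma Wbar_nonempty t : W !=set0 -> Wbar A E W t !=set0.
Proof.
move=> [w Ww]; elim: t => [|t [p Wp]]; first by exists 0; rewrite Wbar0.
rewrite WbarS; exists (E *m w + A *m p), (E *m w); first by exists w.
by exists (A *m p) => //; exists p.
Qed.

Lemma Wbar_nonemptyS t : Wbar A E W t.+1 !=set0 -> W !=set0.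
Proof. by rewrite WbarS => -[_ [_ [w Ww _] _]]; exists w. Qed.

Lemma Wbar_add s t p r :
  Wbar A E W s p -> Wbar A E W t r -> Wbar A E W (s + t) (p + A ^+ s *m r).
Proof.
move=> + Wr; elim: s p => [|s IHs] p.
  by rewrite Wbar0 => ->; rewrite expr0 mul1mx add0r.
rewrite addSn !WbarS => -[_ [w Ww <-] [_ [p' Wp' <-] <-]].
exists (E *m w); first by exists w.
exists (A *m (p' + A ^+ s *m r)); first by exists (p' + A ^+ s *m r); auto.
by rewrite mulmxDr addrA mulmx_exprS.
Qed.

(** Disturbances older than nu steps have been annihilated by A^nu.  A witness
    in W is needed to supply them: without one, Wbar_0 = {0} but Wbar_1 is
    empty. *)
Lemma Wbar_nilpotent_sub nu t :
  W !=set0 -> A ^+ nu = 0 -> (nu <= t)%N -> Wbar A E W nu `<=` Wbar A E W t.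
Proof.
move=> W0 Anu0 /subnKC <- p Wp; have [r Wr] := Wbar_nonempty (t - nu) W0.
by have := Wbar_add Wp Wr; rewrite Anu0 mul0mx addr0.
Qed.

End DisturbanceSets.

(** * Nominal trajectories and reachable sets *)

Section NominalTrajectory.
Context (R : realType) (n m d : nat).
Context (A : 'M[R]_n) (B : 'M[R]_(n, m)) (E : 'M[R]_(n, d)).
Context (W : set 'cV[R]_d).

Fixpoint nominal_state (x : 'cV[R]_n) (u : nat -> 'cV[R]_m) (t : nat) :=
  if t is s.+1 then A *m nominal_state x u s + B *m u s else x.

Lemma nominal_stateE x u t :
  nominal_state x u t =
  A ^+ t *m x + \sum_(1 <= i < t.+1) A ^+ i.-1 *m (B *m u (t - i)%N).
Proof.
elim: t => [|t IHt] /=; first by rewrite big_geq // expr0 mul1mx addr0.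
rewrite [RHS]addrC big_ltn // expr0 mul1mx subn1 /= -addrA addrC; congr (_ + _).
rewrite IHt mulmxDr addrC mulmx_exprS; congr (_ + _).
rewrite [RHS]big_add1 /= mulmx_sumr !big_add1 /=; apply: eq_bigr => i _.
by rewrite mulmx_exprS.
Qed.

Lemma reach_nominal_state x u t :
  reach A B E W x (mkseq u t) = msum [set nominal_state x u t] (Wbar A E W t).
Proof.
rewrite /reach size_mkseq nominal_stateE; congr (msum [set _ + _] _).
apply: eq_big_nat => i /andP[i_gt0 i_le]; rewrite nth_mkseq //.
by rewrite ltn_subrL i_gt0 (leq_trans i_gt0).
Qed.

End NominalTrajectory.

(** * Trajectories inside a robust positively invariant set *)

Section CompanionTrajectory.
Context (R : realType) (n m d : nat).
Context (A : 'M[R]_n) (B : 'M[R]_(n, m)) (E : 'M[R]_(n, d)).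
Context (Sxu : set 'cV[R]_(n + m)) (W : set 'cV[R]_d).
Context (q : nat) (P : 'M[R]_(m * q)) (H : 'M[R]_(m, m * q)).
Context (Cxv : set 'cV[R]_(n + m * q)).
Hypothesis Cxv_RPIS : RPIS (companion_mx A B P H) (companion_dist m E q) W
                           (companion_safe Sxu H) Cxv.
Context (x : 'cV[R]_n) (v : 'cV[R]_(m * q)).
Hypothesis Cxv_xv : Cxv (col_mx x v).

Definition companion_input (t : nat) : 'cV[R]_m := H *m (P ^+ t *m v).

Let xbar := nominal_state A B x companion_input.

Lemma RPIS_nominal_state t p :
  Wbar A E W t p -> Cxv (col_mx (xbar t + p) (P ^+ t *m v)).
Proof.
have [_ Cxv_inv] := Cxv_RPIS.
elim: t p => [|t IHt] p; first by rewrite Wbar0 => ->; rewrite addr0 expr0 mul1mx.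
rewrite WbarS => -[_ [w Ww <-] [_ [p' Wp' <-] <-]].
have := Cxv_inv _ (IHt _ Wp') _ Ww; rewrite companionE.
rewrite mulmx_exprS; congr (Cxv (col_mx _ _)).
rewrite /xbar /= mulmxDr -mulmxA -/(companion_input t) -!addrA; congr (_ + _).
by rewrite addrCA; congr (_ + _); rewrite addrC.
Qed.

Lemma RPIS_nominal_safe t p :
  Wbar A E W t p -> Sxu (col_mx (xbar t + p) (companion_input t)).
Proof.
move=> /RPIS_nominal_state /(proj1 Cxv_RPIS).
by rewrite /companion_safe /= col_mxKu col_mxKd.
Qed.

Lemma nominal_tail_CIS nu :
  W !=set0 -> A ^+ nu = 0 ->
  CIS A B (nominal_safe A E Sxu W nu) [set xbar t | t in [set t | (nu <= t)%N]].
Proof.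
move=> W0 Anu0 _ [t /= le_nu_t <-]; exists (companion_input t); split.
  move=> _ [p Wp [_ -> <-]]; rewrite add_col_mx addr0.
  exact/RPIS_nominal_safe/(Wbar_nilpotent_sub W0 Anu0 le_nu_t).
by exists t.+1 => //=; apply: leqW.
Qed.

End CompanionTrajectory.

Theorem theorem6p3 (R : realType) (n m d : nat)
    (A : 'M[R]_n) (B : 'M[R]_(n, m)) (E : 'M[R]_(n, d)) (nu : nat)
    (Sxu : set 'cV[R]_(n + m)) (W : set 'cV[R]_d)
    (A_nilpotent : nilpotency_index A nu)
    (Sxu_polytope : polytope Sxu) (W_polytope : polytope W)
    (q : nat) (P : 'M[R]_(m * q)) (H : 'M[R]_(m, m * q))
    (Cxv : set 'cV[R]_(n + m * q))
    (Cxv_RPIS : RPIS (companion_mx A B P H) (companion_dist m E q) W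
                     (companion_safe Sxu H) Cxv) :
  proj_fst Cxv `<=` C_outer A B E Sxu W nu.
Proof.
move=> _ [z Cz <-]; rewrite -[z]vsubmxK in Cz.
set x := usubmx z in Cz *; set v := dsubmx z in Cz *.
have [nu_gt0 Anu0 _] := A_nilpotent.
exists [tuple of mkseq (companion_input P H v) nu]; split=> [t lt_t_nu|] /=.
  rewrite nth_mkseq // -map_take take_iota (minn_idPl (ltnW lt_t_nu)).
  rewrite reach_nominal_state.
  move=> _ [_ [_ -> [p Wp <-]] [_ -> <-]].
  exact: (RPIS_nominal_safe Cxv_RPIS Cz).
rewrite reach_nominal_state => _ [_ -> [p Wp <-]].
(* The reachable set may be empty; the point at hand provides a disturbance. *)
have W0 : W !=set0.
  by case: nu nu_gt0 Wp {A_nilpotent Anu0} => // k _ Wp;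
     exact: (Wbar_nonemptyS (ex_intro _ p Wp)).
exists (nominal_state A B x (companion_input P H v) nu); last by exists p.
by apply: (max_CIS_max (nominal_tail_CIS Cxv_RPIS Cz W0 Anu0)); exists nu => /=.
Qed.
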